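(* For all integers $n\geq 0$, $$S(32n+31) \equiv 0 \pmod{16},\qquad S(128n+123) \equiv 0 \pmod{16},\qquad S(512n+491) \equiv 0 \pmod{16}.$$
   Context: For $|q|<1$ (or as formal power series in $q$), let $(a;q)_\infty:=\prod_{k\geq 0}(1-aq^k)$. The function $S(n)$ (the number of overpartitions of $n$ of Schur-type, in the sense of Broudy and Lovejoy) is defined by the generating function $$\sum_{n=0}^{\infty} S(n)q^n = \frac{1}{(q;q^6)_\infty(q^5;q^6)_\infty(q^6;q^6)_\infty}.$$ *)

(* Defs.v *)
From mathcomp Require Import all_boot all_order all_algebra.

Set Implicit Arguments.
Unset Strict Implicit.
Unset Printing Implicit Defensive.

Import Order.TTheory GRing.Theory Num.Theory.
Local Open Scope ring_scope.

(* A formal power series over R is represented by its coefficient sequence. *)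
Definition fps (R : Type) : Type := nat -> R.

Definition fps_one {R : comUnitRingType} : fps R := fun n => (n == 0%N)%:R.

Definition fps_mul {R : comUnitRingType} (F G : fps R) : fps R :=
  fun n => \sum_(i < n.+1) F i * G (n - i)%N.

(* The first n coefficients of 1/F, obtained by solving (1/F) * F = 1 degree  *)
(* by degree; meaningful when F 0 is a unit (see fps_inv_mul).                *)
Fixpoint fps_inv_coefs {R : comUnitRingType} (F : fps R) (n : nat) : seq R :=
  if n is m.+1 then
    let s := fps_inv_coefs F m in
    rcons s (((m == 0%N)%:R - \sum_(i < m) s`_i * F (m - i)%N) / F 0%N)
  else [::].

Definition fps_inv {R : comUnitRingType} (F : fps R) : fps R :=
  fun n => (fps_inv_coefs F n.+1)`_n.

(* (q^a; q^m)_oo for m > 0: the factors of index k > n are 1 modulo q^(n+1),  *)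
(* so the coefficient of q^n is already that of the product over k <= n       *)
(* (see qpoch_coef).                                                          *)
Definition qpoch (a m : nat) : fps int :=
  fun n => (\prod_(k < n.+1) (1 - 'X^(a + m * k)) : {poly int})`_n.

Definition schurS : fps int :=
  fps_inv (fps_mul (fps_mul (qpoch 1 6) (qpoch 5 6)) (qpoch 6 6)).

Lemma size_fps_inv_coefs (R : comUnitRingType) (F : fps R) n :
  size (fps_inv_coefs F n) = n.
Proof. by elim: n => //= n IHn; rewrite size_rcons IHn. Qed.

Lemma nth_fps_inv_coefs (R : comUnitRingType) (F : fps R) n i :
  (i < n)%N -> (fps_inv_coefs F n)`_i = fps_inv F i.
Proof.
elim: n => // n IHn; rewrite ltnS leq_eqVlt => /orP[/eqP-> //|lt_in].
by rewrite /= nth_rcons size_fps_inv_coefs lt_in IHn.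
Qed.

Lemma fps_inv_mul (R : comUnitRingType) (F : fps R) :
  F 0%N \is a GRing.unit -> fps_mul (fps_inv F) F =1 fps_one.
Proof.
move=> F0 n; rewrite /fps_mul big_ord_recr /= subnn.
rewrite {2}/fps_inv /= nth_rcons size_fps_inv_coefs ltnn eqxx divrK //.
rewrite addrC -addrA -[RHS]addr0; congr (_ + _); apply/eqP.
rewrite addrC subr_eq0; apply/eqP/eq_bigr => i _.
by rewrite nth_fps_inv_coefs.
Qed.

Lemma qpoch_coef (a m n N : nat) : (0 < m)%N -> (n < N)%N ->
  (\prod_(k < N) (1 - 'X^(a + m * k)) : {poly int})`_n = qpoch a m n.
Proof.
move=> m_gt0; elim: N => // N IHN; rewrite ltnS leq_eqVlt => /orP[/eqP-> //|ltnN].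
rewrite big_ord_recr /= mulrBr mulr1 coefB IHN // coefMXn.
suff -> : (n < a + m * N)%N by rewrite subr0.
by apply: leq_trans ltnN _; rewrite (leq_trans (leq_pmull N m_gt0)) ?leq_addl.
Qed.

Lemma schurS_genfun :
  fps_mul schurS (fps_mul (fps_mul (qpoch 1 6) (qpoch 5 6)) (qpoch 6 6))
    =1 fps_one.
Proof.
apply: fps_inv_mul.
rewrite /fps_mul !big_ord1 /= /qpoch !big_ord1 /= !coefB !coefXn !coef1 /=.
by rewrite !subr0 !mulr1 unitr1.
Qed.

(* Main.v *)
(* By the triple product the generating function is 1/F with
   F = sum_n (-1)^n q^(3n^2+2n).  Put A(q) = F(-q), P = sum_n q^(3n^2+n),
   f = sum_n q^(3n^2) and y = sum_(n>=0) q^(3n^2+3n).  Splitting the sums by the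
   parity of n gives F = P(q^4) - q A(q^4) and f = f(q^4) + 2 q^3 y(q^4), and
   rotating the lattice Z^2 in F A and in f f(-q) gives
   P^4 - q A^4 = F f(-q)^3.  Hence
     sum_n S(4n+3) q^n = A^3 / (P^4 - q A^4) = A^3 / (F f(-q)^3),
   which dissects again in the same way.  Modulo 16, where f^8 = 1, this yields
     sum_n S(16n+15) q^n = 6 y P^2 + 8 P^3 A^2,
     sum_n S(16n+11) q^n = 7 A^2 f^5 + 8 q (A^5 + y^2 P^2),
   and the congruences follow because P and y are even series and
   G^2 = G(q^2) modulo 2. *)
From HB Require Import structures.
Require Import Defs.
From mathcomp Require Import all_boot all_order all_algebra.
From mathcomp Require Import boolp classical_sets fsbigop zify ring.

Set Implicit Arguments.
Unset Strict Implicit.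
Unset Printing Implicit Defensive.

Import GRing.Theory.
Local Open Scope ring_scope.

(** * The ring of formal power series *)

(** A record, so that the Cauchy product gives the ring structure of a type of its own, distinct
    from the function type. *)
Record series (R : Type) := Series { coef : nat -> R }.
Notation "F .@[ n ]" := (coef F n) (at level 2, format "F .@[ n ]").

Section Ring.
Variable R : comNzRingType.
Implicit Types (F G H : series R) (p : {poly R}) (n N : nat).

Lemma seriesP F G : (forall n, F.@[n] = G.@[n]) -> F = G.
Proof. by case: F G => f [g] /= /funext ->. Qed.

HB.instance Definition _ := gen_eqMixin (series R).
HB.instance Definition _ := gen_choiceMixin (series R).

Definition add_series F G := Series (fun n => F.@[n] + G.@[n]).
Definition opp_series F := Series (fun n => - F.@[n]).
Definition zero_series : series R := Series (fun=> 0).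
Definition one_series : series R := Series (fun n => (n == 0)%:R).
Definition mul_series F G :=
  Series (fun n => \sum_(i < n.+1) F.@[i] * G.@[n - i]).

Fact add_seriesA : associative add_series.
Proof. by move=> F G H; apply: seriesP => n /=; rewrite addrA. Qed.
Fact add_seriesC : commutative add_series.
Proof. by move=> F G; apply: seriesP => n /=; rewrite addrC. Qed.
Fact add_0series : left_id zero_series add_series.
Proof. by move=> F; apply: seriesP => n /=; rewrite add0r. Qed.
Fact add_Nseries : left_inverse zero_series opp_series add_series.
Proof. by move=> F; apply: seriesP => n /=; rewrite addNr. Qed.

HB.instance Definition _ := GRing.isZmodule.Build (series R)
  add_seriesA add_seriesC add_0series add_Nseries.

Definition trunc N F : {poly R} := \poly_(i < N) F.@[i].

(** The coefficient of q^n in a product depends only on coefficients up to n, so commutativity and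
    associativity are inherited from [{poly R}]. *)
Lemma coef_mul_trunc N F G n : (n < N)%N ->
  (mul_series F G).@[n] = (trunc N F * trunc N G)`_n.
Proof.
move=> ltnN; rewrite coefM /=; apply: eq_bigr => -[i] /= lein _.
by rewrite !coef_poly (leq_trans lein ltnN) (leq_ltn_trans (leq_subr _ _) ltnN).
Qed.

Lemma coef_mul_trunc_l N F p n : (n < N)%N ->
  (trunc N F * p)`_n = \sum_(i < n.+1) F.@[i] * p`_(n - i).
Proof.
move=> ltnN; rewrite coefM; apply: eq_bigr => -[i] /= lein _.
by rewrite coef_poly (leq_trans lein ltnN).
Qed.

Fact mul_seriesC : commutative mul_series.
Proof.
by move=> F G; apply: seriesP => n; rewrite !(@coef_mul_trunc n.+1) // mulrC.
Qed.

Fact mul_seriesA : associative mul_series.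
Proof.
have E F G H n : (mul_series F (mul_series G H)).@[n] =
    (trunc n.+1 F * (trunc n.+1 G * trunc n.+1 H))`_n.
  rewrite coef_mul_trunc_l //=; apply: eq_bigr => i _; congr (_ * _).
  by rewrite -coef_mul_trunc // ltnS leq_subr.
move=> F G H; apply: seriesP => n; rewrite (mul_seriesC (mul_series F G)) !E.
by rewrite (mulrC (trunc n.+1 H)) mulrA.
Qed.

Fact mul_1series : left_id one_series mul_series.
Proof.
move=> F; apply: seriesP => n /=; rewrite big_ord_recl /= subn0 mul1r.
by rewrite big1 ?addr0 // => i _; rewrite mul0r.
Qed.

Fact mul_seriesDl : left_distributive mul_series add_series.
Proof.
move=> F G H; apply: seriesP => n /=; rewrite -big_split /=.
by apply: eq_bigr => i _; rewrite mulrDl.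
Qed.

Fact one_series_neq0 : one_series != zero_series.
Proof. by apply/eqP => /(congr1 (fun F => F.@[0])) /eqP; rewrite /= oner_eq0. Qed.

HB.instance Definition _ := GRing.Zmodule_isComNzRing.Build (series R)
  mul_seriesA mul_seriesC mul_1series mul_seriesDl one_series_neq0.

Definition Xs : series R := Series (fun n => (n == 1)%:R).
End Ring.
Arguments Xs {R}.

(** * Substitutions in power series and 4-dissections *)

Section Morphisms.
Variable R : comNzRingType.
Implicit Types (F G H : series R) (n m : nat).

Lemma coefsM F G n : (F * G).@[n] = \sum_(i < n.+1) F.@[i] * G.@[n - i].
Proof. by []. Qed.
Lemma coefsD F G n : (F + G).@[n] = F.@[n] + G.@[n].
Proof. by []. Qed.
Lemma coefsN F n : (- F).@[n] = - F.@[n].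
Proof. by []. Qed.
Lemma coefs1 n : (1 : series R).@[n] = (n == 0)%:R.
Proof. by []. Qed.

Lemma coefsMn F k n : (F *+ k).@[n] = F.@[n] *+ k.
Proof. by elim: k => // k IHk; rewrite !mulrS coefsD IHk. Qed.

Lemma coefs_natM F k n : (k%:R * F).@[n] = k%:R * F.@[n].
Proof. by rewrite mulr_natl coefsMn mulr_natl. Qed.

Lemma coefsXM F n : (Xs * F).@[n] = if n is n'.+1 then F.@[n'] else 0.
Proof.
rewrite coefsM; case: n => [|n]; first by rewrite big_ord1 mul0r.
rewrite big_ord_recl mul0r add0r big_ord_recl /= mul1r subSS subn0.
by rewrite big1 ?addr0 // => i _; rewrite mul0r.
Qed.

Lemma coefsXnM F k n :
  (Xs ^+ k * F).@[n] = if (n < k)%N then 0 else F.@[n - k].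
Proof.
elim: k n => [|k IHk] n; first by rewrite mul1r subn0.
by rewrite exprS -mulrA coefsXM; case: n => // n; rewrite IHk.
Qed.

(* q |-> q ^ m *)
Definition dil m F : series R :=
  Series (fun n => if (m %| n)%N then F.@[n %/ m] else 0).

(** The substitution q |-> -q. *)
Definition alt F : series R := Series (fun n => (-1) ^+ n * F.@[n]).

Lemma coef_alt F n : (alt F).@[n] = (-1) ^+ n * F.@[n].
Proof. by []. Qed.

Lemma alt_is_zmod : zmod_morphism alt.
Proof. by move=> F G; apply: seriesP => n /=; rewrite mulrBr. Qed.

Lemma alt_is_monoid : monoid_morphism alt.
Proof.
split; first by apply: seriesP => -[|n] /=; rewrite ?mulr1 ?mulr0.
move=> F G; apply: seriesP => n; rewrite /= mulr_sumr.
apply: eq_bigr => -[i] /= lein _; rewrite mulrACA -exprD subnKC //.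
Qed.

HB.instance Definition _ := GRing.isZmodMorphism.Build _ _ alt alt_is_zmod.
HB.instance Definition _ := GRing.isMonoidMorphism.Build _ _ alt alt_is_monoid.

Lemma altX : alt Xs = - Xs.
Proof.
by apply: seriesP => -[|[|n]] /=; rewrite ?expr1 ?mulr1 ?mulr0 ?oppr0.
Qed.

Section Dilation.
Variable m' : nat.
Let m := m'.+1.

Lemma coef_dilM F n : (dil m F).@[m * n] = F.@[n].
Proof. by rewrite /= dvdn_mulr // mulKn. Qed.

Lemma coef_dilM_mod F n r : (0 < r < m)%N -> (dil m F).@[m * n + r] = 0.
Proof.
case/andP=> r0 rm; rewrite /= dvdn_addr ?dvdn_mulr //.
by rewrite gtnNdvd.
Qed.

Lemma dil_inj : injective (dil m).
Proof.
by move=> F G E; apply: seriesP => n; rewrite -(coef_dilM F) -(coef_dilM G) E.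
Qed.

Lemma dil_is_zmod : zmod_morphism (dil m).
Proof. by move=> F G; apply: seriesP => n /=; case: ifP; rewrite ?subr0. Qed.

Lemma dil_is_monoid : monoid_morphism (dil m).
Proof.
split.
  apply: seriesP => -[|n] //; rewrite /dil [LHS]/=; case: ifP => // d.
  by rewrite coefs1 gtn_eqF // divn_gt0 // dvdn_leq.
move=> F G; apply: seriesP => n.
have [r [j [rm ->]]] : exists r j, (r < m)%N /\ n = (m * j + r)%N.
  exists (n %% m)%N, (n %/ m)%N; split; first exact: ltn_pmod.
  by rewrite mulnC -divn_eq.
rewrite coefsM.
rewrite -(big_mkord xpredT (fun i => (dil m F).@[i] * (dil m G).@[m * j + r - i])).
case: r rm => [|r] rm.
  rewrite addn0 coef_dilM coefsM.
  (* Only the summation bound varies, [j] stays fixed: each induction step adds a block of [m]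
     indices, of which the last alone is a multiple of [m]. *)
  have E j' : (j' <= j)%N ->
      \sum_(0 <= i < (m * j').+1) (dil m F).@[i] * (dil m G).@[m * j - i] =
      \sum_(0 <= i < j'.+1) F.@[i] * G.@[j - i].
    elim: j' => [|k IHk] lekj.
      by rewrite muln0 !big_nat1 subn0 !(coef_dilM G) -(coef_dilM F) muln0 subn0.
    rewrite [RHS]big_nat_recr // -IHk /=; last exact: ltnW.
    rewrite (@big_cat_nat _ _ _ (m * k).+1) /=; last 2 first.
    - by [].
    - by rewrite ltnS leq_pmul2l.
    congr (_ + _); rewrite big_nat_recr /=; last by rewrite ltn_pmul2l.
    rewrite big_nat big1 ?add0r => [|i /andP[l1 l2]].
      by rewrite -mulnBr !dvdn_mulr // !mulKn.
    suff -> : (m %| i)%N = false by rewrite mul0r.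
    apply/negP => /dvdnP[t it]; move: l1 l2.
    rewrite it ![(m * _)%N]mulnC ltn_pmul2r // ltn_pmul2r //.
    by lia.
  by rewrite E // big_mkord.
(* For r > 0 the two indices sum to a non-multiple of [m], so they cannot both be multiples. *)
rewrite coef_dilM_mod // big_nat big1 // => i /andP[_]; rewrite ltnS => lei.
rewrite /=; case: ifP => d; last by rewrite mul0r.
by rewrite dvdn_subl // dvdn_addr ?dvdn_mulr // gtnNdvd // mulr0.
Qed.

HB.instance Definition _ := GRing.isZmodMorphism.Build _ _ (dil m) dil_is_zmod.
HB.instance Definition _ := GRing.isMonoidMorphism.Build _ _ (dil m) dil_is_monoid.
End Dilation.

Lemma alt_dil m F : ~~ odd m -> alt (dil m F) = dil m F.
Proof.
move=> m_even; apply: seriesP => n; rewrite /=; case: ifP => [/dvdnP[j ->]|_].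
  by rewrite -signr_odd oddM (negPf m_even) andbF mul1r.
by rewrite mulr0.
Qed.

Lemma altK : involutive alt.
Proof. by move=> F; apply: seriesP => n; rewrite !coef_alt mulrA -expr2 sqrr_sign mul1r. Qed.

Lemma dil_dil m n F : (0 < m)%N -> dil m (dil n F) = dil (m * n) F.
Proof.
move=> m0; apply: seriesP => k /=; case: (boolP (m %| k)%N) => [dk|ndk].
  by rewrite dvdn_divRL // mulnC divnMA.
case: ifP => // dk; case/negP: ndk; exact: dvdn_trans (dvdn_mulr _ _) dk.
Qed.

Lemma dilX m : dil m.+1 Xs = Xs ^+ m.+1 :> series R.
Proof.
apply: seriesP => k; rewrite -[Xs ^+ m.+1]mulr1 coefsXnM coefs1 /=.
case: ifP => [/dvdnP[j ->]|ndk].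
  rewrite mulnK //; case: j => [|[|j]]; rewrite ?mul0n // ?mul1n ?ltnn ?subnn //.
  by rewrite mulSn ltnNge leq_addr addKn mulSn addSn.
case: ltnP => // lek; case: eqP => // E; case/negP: ndk.
by apply/dvdnP; exists 1%N; lia.
Qed.

Lemma coefsXnM_dil m r t F n : (r < m)%N -> (t < m)%N ->
  (Xs ^+ r * dil m F).@[m * n + t] = if r == t then F.@[n] else 0.
Proof.
case: m => // m rm tm; rewrite coefsXnM; case: (ltngtP r t) => [rt|tr|->].
- rewrite (_ : m.+1 * n + t < r = false)%N; last by lia.
  rewrite (_ : m.+1 * n + t - r = m.+1 * n + (t - r))%N; last by lia.
  by rewrite coef_dilM_mod //; lia.
- case: n => [|n]; first by rewrite muln0 tr.
  rewrite mulnS (_ : m.+1 + m.+1 * n + t < r = false)%N; last by lia.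
  rewrite (_ : m.+1 + m.+1 * n + t - r = m.+1 * n + (m.+1 + t - r))%N; last by lia.
  by rewrite coef_dilM_mod //; lia.
- by rewrite ltnNge leq_addl addnK coef_dilM.
Qed.

Definition dissect4 (B0 B1 B2 B3 : series R) :=
  dil 4 B0 + Xs * dil 4 B1 + Xs ^+ 2 * dil 4 B2 + Xs ^+ 3 * dil 4 B3.

Lemma coef_dissect4 B0 B1 B2 B3 n r : (r < 4)%N ->
  (dissect4 B0 B1 B2 B3).@[4 * n + r] = (nth 0 [:: B0; B1; B2; B3] r).@[n].
Proof.
move=> r4; rewrite /dissect4 -[dil 4 B0]mul1r -(expr0 Xs) -[X in X * dil 4 B1]expr1.
rewrite !coefsD !coefsXnM_dil //.
by case: r r4 => [|[|[|[|]]]] // _; rewrite ?addr0 ?add0r.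
Qed.

Lemma coef_dissect4_2 B0 B1 B2 B3 n :
  (dissect4 B0 B1 B2 B3).@[4 * n + 2] = B2.@[n].
Proof. exact: coef_dissect4. Qed.

Lemma coef_dissect4_3 B0 B1 B2 B3 n :
  (dissect4 B0 B1 B2 B3).@[4 * n + 3] = B3.@[n].
Proof. exact: coef_dissect4. Qed.
End Morphisms.

(** * Generating series of weighted families *)

(** Finiteness of every sublevel set, the condition under which sums over an infinite family may be
    reindexed, split and multiplied. *)
Definition locfin (I : choiceType) (e : I -> nat) :=
  forall k, exists s : seq I, forall i, (e i <= k)%N -> i \in s.

Section GenSer.
Variable R : comNzRingType.

(* The sum of w i * q ^ e i over all i; a coefficient is a junk 0 when infinitely
   many nonzero weights contribute to it, which [locfin e] excludes. *)
Definition gser (I : choiceType) (e : I -> nat) (w : I -> R) : series R :=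
  Series (fun k => \sum_(i \in [set i | e i = k]) w i).

(** Turns a finitely supported sum into a big operator over any convenient list that contains the
    level set. *)
Lemma gser_coef (I : choiceType) (e : I -> nat) (w : I -> R) k (s : seq I) :
  uniq s -> (forall i, e i = k -> i \in s) ->
  (gser e w).@[k] = \sum_(i <- s | e i == k) w i.
Proof.
move=> us es; rewrite /= (fsbigE [seq i <- s | e i == k]) ?filter_uniq //.
- rewrite big_filter_cond; apply: eq_bigl => i; rewrite andb_idr //.
  by move=> /eqP ek; rewrite inE.
- by move=> i /=; rewrite mem_filter => /andP[/eqP].
- by move=> i /= ek; rewrite mem_filter es ek // eqxx.
Qed.

Lemma locfinP (I : choiceType) (e : I -> nat) k : locfin e ->
  exists2 s : seq I, uniq s & forall i, (e i <= k)%N -> i \in s.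
Proof.
by case/(_ k) => s es; exists (undup s); rewrite ?undup_uniq // => i /es; rewrite mem_undup.
Qed.

Lemma gser_reindex (I J : choiceType) (h : J -> I) (e : I -> nat) (w : I -> R) :
  injective h -> (forall i, exists j, h j = i) -> locfin e ->
  gser e w = gser (e \o h) (w \o h).
Proof.
move=> hI hs le; apply: seriesP => k; have [s us es] := locfinP k le.
have [t ts] : exists t, [seq h j | j <- t] = s.
  elim: s {us es} => [|i s [t <-]]; first by exists [::].
  by have [j <-] := hs i; exists (j :: t).
move: us; rewrite -ts in es *; rewrite map_inj_uniq // => ut.
rewrite (@gser_coef _ _ _ _ [seq h j | j <- t]) ?map_inj_uniq //; last first.
  by move=> i ei; apply: es; rewrite ei.
rewrite big_map -(@gser_coef _ _ (w \o h)) // => j ej.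
by rewrite -(mem_map hI); apply: es; rewrite -ej.
Qed.

Lemma locfin_inj (I J : choiceType) (h : J -> I) (e : I -> nat) :
  injective h -> locfin e -> locfin (e \o h).
Proof.
move=> hI le k; have [s es] := le k.
(* Preimages under [h] are chosen classically; elements of [s] outside the image are dropped. *)
exists (pmap (fun i => if pselect (exists j, h j = i) is left E
  then Some (projT1 (cid E)) else None) s).
move=> j /es hs; rewrite mem_pmap; apply/mapP; exists (h j) => //.
case: pselect => [E|[]]; last by exists j.
by congr Some; apply: hI; rewrite (projT2 (cid E)).
Qed.

Lemma gser_sum (I J : choiceType) (e : I + J -> nat) (w : I + J -> R) :
  locfin e ->
  gser e w = gser (e \o inl) (w \o inl) + gser (e \o inr) (w \o inr).
Proof.
move=> le; apply: seriesP => k; rewrite coefsD.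
have [s us es] := locfinP k (locfin_inj inl_inj le).
have [t ut et] := locfinP k (locfin_inj inr_inj le).
have es' i : e (inl i) = k -> i \in s by move=> ei; apply: es; rewrite /= ei.
have et' i : e (inr i) = k -> i \in t by move=> ei; apply: et; rewrite /= ei.
rewrite (@gser_coef _ _ _ _ s us es') (@gser_coef _ _ _ _ t ut et').
rewrite (@gser_coef _ _ _ _ (map inl s ++ map inr t)) ?big_cat ?big_map //=.
  rewrite cat_uniq !map_inj_uniq ?us ?ut => [|? ? []//|? ? []//].
  by rewrite andbT /=; apply/hasPn => i /mapP[j _ ->]; apply/negP => /mapP[].
case=> i ei; rewrite mem_cat; apply/orP; [left|right]; apply: map_f.
  exact: es'.
exact: et'.
Qed.

Lemma gserM (I J : choiceType) (e : I -> nat) (w : I -> R)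
    (f : J -> nat) (v : J -> R) :
  locfin e -> locfin f ->
  gser e w * gser f v =
  gser (fun p : I * J => (e p.1 + f p.2)%N) (fun p => w p.1 * v p.2).
Proof.
move=> le lf; apply: seriesP => k; rewrite coefsM.
have [s us es] := locfinP k le; have [t ut et] := locfinP k lf.
rewrite (@gser_coef _ _ _ _ (allpairs pair s t)); first last.
- case=> i j /= eij; apply: allpairs_f; [apply: es|apply: et].
    by rewrite -eij leq_addr.
  by rewrite -eij leq_addl.
- by rewrite allpairs_uniq //; case=> ? ? [].
rewrite [RHS]big_mkcond big_allpairs_dep.
under [LHS]eq_bigr => n _.
  rewrite (@gser_coef _ _ _ _ s) //; last first.
    by move=> i ei; apply: es; rewrite ei -ltnS.
  rewrite (@gser_coef _ _ _ _ t) //; last first.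
    by move=> i ei; apply: et; rewrite ei leq_subr.
  rewrite mulr_suml; over.
(* For fixed [i] only the degree n = e i contributes; when it exceeds [k], both sides vanish. *)
rewrite (exchange_big_dep xpredT) //=; apply: eq_bigr => i _.
rewrite -big_mkcond /=; have [lek|gtk] := leqP (e i) k.
  rewrite (big_pred1 (inord (e i))) => [|n]; last first.
    by rewrite /= -val_eqE /= inordK // eq_sym.
  rewrite inordK // mulr_sumr; apply: eq_bigl => j.
  by rewrite -(eqn_add2l (e i)) subnKC.
rewrite !big1 // => [j /eqP|n /eqP].
  by move: gtk => /[swap] <-; rewrite ltnNge leq_addr.
by move=> en; move: (ltn_ord n); rewrite -en ltnS leqNgt gtk.
Qed.

Lemma locfinM (I J : choiceType) (e : I -> nat) (f : J -> nat) :
  locfin e -> locfin f -> locfin (fun p : I * J => (e p.1 + f p.2)%N).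
Proof.
move=> le lf k; have [s es] := le k; have [t et] := lf k.
exists (allpairs pair s t) => -[i j] /= eij; apply: allpairs_f; [apply: es|apply: et].
  exact: leq_trans (leq_addr _ _) eij.
exact: leq_trans (leq_addl _ _) eij.
Qed.

Lemma eq_gser (I : choiceType) (e f : I -> nat) (w v : I -> R) :
  e =1 f -> w =1 v -> gser e w = gser f v.
Proof. by move=> /funext -> /funext ->. Qed.

Lemma gserN (I : choiceType) (e : I -> nat) (w : I -> R) :
  locfin e -> gser e (fun i => - w i) = - gser e w.
Proof.
move=> le; apply: seriesP => k; have [s us es] := locfinP k le.
have es' i : e i = k -> i \in s by move=> ei; apply: es; rewrite ei.
by rewrite coefsN !(@gser_coef _ _ _ _ s) // sumrN.
Qed.

Lemma gserXnM (I : choiceType) (e : I -> nat) (w : I -> R) m :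
  gser (fun i => m + e i)%N w = Xs ^+ m * gser e w.
Proof.
apply: seriesP => k; rewrite coefsXnM; case: ltnP => [ltkm|lemk] /=.
  rewrite (_ : [set i | _] = set0)%classic ?fsbig_set0 //.
  by apply/seteqP; split=> i //= E; move: ltkm; rewrite -E ltnNge leq_addr.
rewrite (_ : [set i | m + e i = k]%N = [set i | e i = k - m]%N)%classic //.
by apply/seteqP; split=> i /= => [<-|->]; rewrite ?addKn ?subnKC.
Qed.

Lemma dil_gser (I : choiceType) (e : I -> nat) (w : I -> R) m :
  dil m.+1 (gser e w) = gser (fun i => m.+1 * e i)%N w.
Proof.
apply: seriesP => k /=; case: ifP => [/dvdnP[j ->]|ndvd].
  rewrite mulnK // (_ : [set i | m.+1 * e i = j * m.+1]%N = [set i | e i = j]%N)%classic //.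
  apply/seteqP; split=> i /= => [/eqP|->]; last by rewrite mulnC.
  by rewrite mulnC eqn_pmul2r // => /eqP.
rewrite (_ : [set i | _] = set0)%classic ?fsbig_set0 //.
by apply/seteqP; split=> i //= E; rewrite -E dvdn_mulr in ndvd.
Qed.

Lemma alt_gser (I : choiceType) (e : I -> nat) (w : I -> R) : locfin e ->
  alt (gser e w) = gser e (fun i => (-1) ^+ e i * w i).
Proof.
move=> le; apply: seriesP => k; have [s us es] := locfinP k le.
have es' i : e i = k -> i \in s by move=> ei; apply: es; rewrite ei.
rewrite coef_alt !(@gser_coef _ _ _ _ s) // mulr_sumr.
by apply: eq_bigr => i /eqP ->.
Qed.
(** The two injections with disjoint, jointly covering images form a bijection from [J + K]. Every
    theta dissection below is an instance. *)
Lemma gser_split (I J K : choiceType) (h1 : J -> I) (h2 : K -> I)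
    (e : I -> nat) (w : I -> R) :
  injective h1 -> injective h2 -> (forall j k, h1 j <> h2 k) ->
  (forall i, (exists j, h1 j = i) \/ (exists k, h2 k = i)) -> locfin e ->
  gser e w = gser (e \o h1) (w \o h1) + gser (e \o h2) (w \o h2).
Proof.
move=> i1 i2 i12 s12 le.
pose h (x : J + K) := match x with inl j => h1 j | inr k => h2 k end.
have hI : injective h.
  case=> [x|x] [y|y] /=; first by move/i1->.
  - by move/i12.
  - by move/esym/i12.
  - by move/i2->.
rewrite (@gser_reindex _ _ h) //; first by rewrite gser_sum //; exact: locfin_inj.
by move=> i; case: (s12 i) => [[j <-]|[k <-]]; [exists (inl j)|exists (inr k)].
Qed.

Lemma gserXM (I : choiceType) (e : I -> nat) (w : I -> R) :
  gser (fun i => 1 + e i)%N w = Xs * gser e w.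
Proof. exact: gserXnM. Qed.

Lemma gser_even (I : choiceType) (e : I -> nat) (w : I -> R) :
  (forall i, ~~ odd (e i)) -> exists G, gser e w = dil 2 G.
Proof.
move=> e_even; exists (gser (fun i => (e i)./2) w); rewrite dil_gser.
by apply: eq_gser => // i; rewrite mul2n even_halfK.
Qed.
End GenSer.

(** * Theta series *)

(** For d <= 3 the quadratic form is nonnegative on all integers, so the absolute value only changes
    the type. *)
Definition qexp (d : nat) (n : int) : nat := `|3 * n ^+ 2 + d%:Z * n|.

Lemma qexpE d n : (d <= 3)%N -> (qexp d n)%:Z = 3 * n ^+ 2 + d%:Z * n.
Proof.
move=> d3; rewrite /qexp gez0_abs //; case: n => n; first by rewrite expr2; nia.
by rewrite NegzE expr2; nia.
Qed.

Lemma locfin_qexp d : (d <= 3)%N -> locfin (qexp d).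
Proof.
move=> d3 k; exists ([seq Posz i | i <- iota 0 k.+1] ++ [seq Negz i | i <- iota 0 k.+1]).
move=> n le; rewrite mem_cat; apply/orP.
have: ((qexp d n)%:Z <= k%:Z)%R by lia.
rewrite qexpE // expr2; case: n {le} => i le; [left|right]; apply: map_f;
  rewrite mem_iota /= add0n; rewrite ?NegzE in le; nia.
Qed.

Lemma posz_inj (m n : nat) : m%:Z = n%:Z -> m = n.
Proof. by case. Qed.

Lemma odd_abszD (m n : int) : odd `|m + n| = odd `|m| (+) odd `|n|.
Proof. lia. Qed.

Section Theta.
Variable R : comNzRingType.

(* With [d] = 1, 2, 0, [thetaP d] is P, A, f, and [thetaM 2] is F = A(-q). *)
Definition sgnz (n : int) : R := (-1) ^+ `|n|%N.
Definition thetaP d := gser (qexp d) (fun=> 1 : R).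
Definition thetaM d := gser (qexp d) sgnz.
(** This is psi(q^6) in Ramanujan's notation, where [thetaP 0] is phi(q^3). *)
Definition psi3 := gser (fun n : nat => 3 * (n * n + n))%N (fun=> 1 : R).

Lemma sgnzD m n : sgnz (m + n) = sgnz m * sgnz n.
Proof. by rewrite /sgnz -signr_odd odd_abszD signr_addb !signr_odd. Qed.

Lemma sgnzN n : sgnz (- n) = sgnz n.
Proof. by rewrite /sgnz abszN. Qed.

Lemma int_parity (n : int) : exists m : int, n = 2 * m \/ n = 2 * m + 1.
Proof. exists (n %/ 2)%Z; lia. Qed.

(** n = 2m gives the exponent 4(3m^2+m). Odd n are written -(2m+1), so that the exponent is 1 +
    4(3m^2+2m) without a further shift. *)
Lemma thetaP2_split : thetaP 2 = dil 4 (thetaP 1) + Xs * dil 4 (thetaP 2).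
Proof.
rewrite /thetaP [LHS](@gser_split _ _ _ _ (fun m : int => 2 * m)
  (fun m : int => - (2 * m + 1))).
- rewrite !dil_gser -gserXM; congr (_ + _); apply: eq_gser => // m;
  by apply: posz_inj; rewrite /= ?PoszD ?PoszM !qexpE //; ring.
- by move=> m n /=; lia.
- by move=> m n /=; lia.
- by move=> m n /=; lia.
- move=> n; have [m [->|->]] := int_parity n; first by left; exists m.
  by right; exists (- m - 1); lia.
- exact: locfin_qexp.
Qed.

(** For even d, 3n^2+dn has the parity of n. *)
Lemma alt_thetaP d : ~~ odd d -> (d <= 3)%N -> alt (thetaP d) = thetaM d.
Proof.
move=> d_even d3; rewrite alt_gser; last exact: locfin_qexp.
apply: eq_gser => // n; rewrite mulr1 /sgnz -signr_odd -[RHS]signr_odd.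
by rewrite /qexp expr2 odd_abszD !abszM !oddM /= (negPf d_even) andbb addbF.
Qed.

Lemma thetaM2_split : thetaM 2 = dil 4 (thetaP 1) - Xs * dil 4 (thetaP 2).
Proof.
by rewrite -alt_thetaP // {1}thetaP2_split rmorphD rmorphM /= !alt_dil // altX mulNr.
Qed.

(** n = 2m+1 gives 3 + 12(m^2+m), which is invariant under m |-> -1-m; hence the nonnegative and the
    negative m each contribute one copy of [psi3]. *)
Lemma thetaP0_split : thetaP 0 = dil 4 (thetaP 0) + 2 * Xs ^+ 3 * dil 4 psi3.
Proof.
rewrite /thetaP [LHS](@gser_split _ _ _ _ (fun m : int => 2 * m)
  (fun m : int => 2 * m + 1)).
- congr (_ + _).
    rewrite dil_gser; apply: eq_gser => // m.
    by apply: posz_inj; rewrite /= ?PoszM !qexpE //; ring.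
  rewrite (@gser_split _ _ _ _ Posz Negz).
  + rewrite -mulrA mulr_natl mulr2n /psi3 dil_gser -gserXnM.
    congr (_ + _); apply: eq_gser => // m.
      by apply: posz_inj; rewrite /= qexpE //; lia.
    by apply: posz_inj; rewrite /= qexpE // NegzE; lia.
  + by move=> m n [].
  + by move=> m n [].
  + by [].
  + by case=> i; [left; exists i|right; exists i].
  + by apply: locfin_inj (locfin_qexp _) => // m n; lia.
- by move=> m n /=; lia.
- by move=> m n /=; lia.
- by move=> m n /=; lia.
- by move=> n; have [m [->|->]] := int_parity n; [left; exists m|right; exists m].
- exact: locfin_qexp.
Qed.

Lemma thetaM0_split : thetaM 0 = dil 4 (thetaP 0) - 2 * Xs ^+ 3 * dil 4 psi3.
Proof.
rewrite -alt_thetaP // {1}thetaP0_split rmorphD 2!rmorphM /= rmorphXn /= altX.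
by rewrite rmorph_nat !alt_dil //; ring.
Qed.

(** The terms of n and -n agree, and n = 0 contributes 1. *)
Lemma thetaP0_mod2 : exists x, thetaP 0 = 1 + 2 * x.
Proof.
pose e k := qexp 0 (Posz k.+1); exists (gser e (fun=> 1)).
rewrite /thetaP [LHS](@gser_split _ _ unit (nat + nat)%type (fun=> 0)
  (fun x => match x with inl k => Posz k.+1 | inr k => Negz k end)).
- congr (_ + _).
    apply: seriesP => k; rewrite (@gser_coef _ _ _ _ _ [:: tt]) => [||[]] //.
    by rewrite big_mkcond big_seq1 /= (_ : qexp 0 0 = 0%N) //; case: k.
  rewrite gser_sum; last first.
    by apply: locfin_inj (locfin_qexp _) => // -[] i [] j [] // ->.
  rewrite mulr_natl mulr2n; congr (_ + _); apply: eq_gser => // k.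
- by do 2!case.
- by move=> [] i [] j [] // ->.
- by move=> _ [].
- by case=> [[|k]|k]; [left; exists tt|right; exists (inl k)|right; exists (inr k)].
- exact: locfin_qexp.
Qed.

Lemma thetaM0_mod2 : exists x, thetaM 0 = 1 + 2 * x.
Proof.
have [x E] := thetaP0_mod2; exists (alt x).
by rewrite -alt_thetaP // E rmorphD rmorphM /= rmorph1 rmorph_nat.
Qed.

(* Lattice rotation: (n, m) = (u + v, u - v) when n + m is even; the terms with
   n + m odd cancel under v |-> -1 - v, which swaps n and m. *)
Lemma thetaM_mul_thetaP d : (d <= 3)%N ->
  thetaM d * thetaP d = dil 2 (thetaM d * thetaM 0).
Proof.
move=> d3; have ld := locfin_qexp d3; have l0 := @locfin_qexp 0 isT.
rewrite !gserM // dil_gser.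
rewrite (@gser_split _ _ _ _ (fun p : int * int => (p.1 + p.2, p.1 - p.2))
   (fun p : int * int => (p.1 + p.2 + 1, p.1 - p.2))).
- set S2 := gser (_ \o (fun p : int * int => (p.1 + p.2 + 1, p.1 - p.2))) _.
  suff -> : S2 = 0.
    rewrite addr0; apply: eq_gser => -[u v] /=.
      by apply: posz_inj; rewrite PoszM !PoszD !qexpE //; ring.
    by rewrite sgnzD mulr1.
  rewrite /S2 (@gser_split _ _ _ _ (fun p : int * nat => (p.1, Posz p.2))
    (fun p : int * nat => (p.1, Negz p.2))).
  + set G := gser _ _; set G' := gser _ _.
    suff -> : G' = - G by rewrite subrr.
    rewrite /G -gserN; last first.
      apply: locfin_inj; first by move=> [i m] [j n] [-> ->].
      by apply: locfin_inj (locfinM ld ld) => -[i m] [j n] [] /= ? ?; congr pair; lia.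
    apply: eq_gser => -[u k] /=.
      rewrite addnC NegzE; congr (qexp _ _ + qexp _ _)%N; lia.
    rewrite !mulr1 !sgnzD NegzE sgnzN.
    rewrite (_ : Posz k.+1 = Posz k + 1) ?sgnzD; last by lia.
    by rewrite /sgnz /= expr1; ring.
  + by move=> [i m] [j n] [-> ->].
  + by move=> [i m] [j n] [-> ->].
  + by move=> [i m] [j n].
  + by case=> u [k|k]; [left; exists (u, k)|right; exists (u, k)].
  + by apply: locfin_inj (locfinM ld ld) => -[i m] [j n] [] /= ? ?; congr pair; lia.
- by move=> [i m] [j n] [] /= ? ?; congr pair; lia.
- by move=> [i m] [j n] [] /= ? ?; congr pair; lia.
- by move=> [i m] [j n] [] /= ? ?; lia.
- case=> i j; have [c [E|E]] := int_parity (i + j).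
    by left; exists (c, i - c); congr pair; rewrite /=; lia.
  by right; exists (c, i - c - 1); congr pair; rewrite /=; lia.
- exact: locfinM.
Qed.
End Theta.

(** * The quartic theta identity *)

Section Quartic.
Variable R : comNzRingType.

Notation P := (thetaP R 1).
Notation A := (thetaP R 2).
Notation F := (thetaM R 2).
Notation f := (thetaP R 0).
Notation fm := (thetaM R 0).

(** After q |-> q^2 both sides equal F A f fm: grouped as (F fm)(A f) it is a difference of squares,
    grouped as (F A)(fm f) the lattice rotation applies to each factor. *)
Lemma theta_quartic : P ^+ 4 - Xs * A ^+ 4 = F * fm ^+ 3.
Proof.
have FA := @thetaM_mul_thetaP R 2 isT; have ff := @thetaM_mul_thetaP R 0 isT.
(* Dilated by 2 the left side becomes F A, a difference of squares by the dissections of F and A. *)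
have Ffm : F * fm = dil 2 P ^+ 2 - Xs * dil 2 A ^+ 2.
  apply: (@dil_inj _ 1); rewrite -FA thetaM2_split {2}thetaP2_split.
  rewrite rmorphB rmorphXn (rmorphM _ Xs) rmorphXn /= !dil_dil // dilX.
  rewrite (_ : 2 * 2 = 4)%N //; ring.
(* The image of the previous identity under q |-> -q. *)
have Af : A * f = dil 2 P ^+ 2 + Xs * dil 2 A ^+ 2.
  have := congr1 (@alt R) Ffm; rewrite -!alt_thetaP //.
  rewrite rmorphB rmorphXn (rmorphM _ Xs) rmorphXn rmorphM /= !altK.
  by rewrite altX !alt_dil // mulNr opprK.
apply: (@dil_inj _ 1).
transitivity ((F * fm) * (A * f)).
  by rewrite Ffm Af rmorphB rmorphXn (rmorphM _ Xs) rmorphXn /= dilX; ring.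
transitivity ((F * A) * (fm * f)); first by ring.
by rewrite FA ff -rmorphM /=; congr dil; ring.
Qed.
End Quartic.

(** * Dissections modulo 16 *)

(** Pairing i with n - i doubles all terms but the middle one, present for even n; this serves to
    square a series modulo 2. *)
Lemma sum_symm_pairs (V : zmodType) (u : nat -> V) n :
  (forall i, (i <= n)%N -> u (n - i)%N = u i) ->
  \sum_(i < n.+1) u i =
  (\sum_(i < n.+1 | (i.*2 < n)%N) u i) *+ 2 + (if odd n then 0 else u n./2).
Proof.
move=> sym; rewrite (bigID (fun i : 'I_n.+1 => (i.*2 < n)%N)) /= mulr2n -addrA.
congr (_ + _); rewrite (bigID (fun i : 'I_n.+1 => (n < i.*2)%N)) /=; congr (_ + _).
  rewrite (reindex_inj rev_ord_inj) /=; apply: eq_big => [i|i _].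
    by have := ltn_ord i; rewrite subSS; lia.
  by rewrite subSS sym // -ltnS.
case: ifP => n_odd; first by rewrite big1 // => i H; exfalso; lia.
have n2 : (n./2 < n.+1)%N by lia.
rewrite (big_pred1 (inord n./2)) => [|i]; first by rewrite inordK.
by rewrite /= -val_eqE /= inordK //; lia.
Qed.

(** * Polynomial identities behind the dissections, with [h] standing for [dil 4] *)

Section Expansions.
Variables (L : comNzRingType) (h : {rmorphism L -> L}) (X P A f y D : L).
Hypotheses (hX : h X = X ^+ 4) (L16 : 16 = 0 :> L).

(** The factorization of p^4 - X^4 a^4 by p - X a, with X^4 = h X. *)
Lemma linear_quartic_expand : (h P - X * h A) *
  (h (P ^+ 3 * D) + X * h (P ^+ 2 * A * D) + X ^+ 2 * h (P * A ^+ 2 * D)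
   + X ^+ 3 * h (A ^+ 3 * D)) =
  h ((P ^+ 4 - X * A ^+ 4) * D).
Proof. by rewrite !(rmorphD, rmorphN, rmorphM, rmorphXn) /= hX; ring. Qed.

(** The left side is A^3 f(-q)^5 S with each factor 4-dissected, [D] being the inverse of the
    quartic. Only the components of residues 2 and 3 are used later. *)
Lemma A3V_expand : exists B0 B1,
  (h P + X * h A) ^+ 3 * (h f - 2 * X ^+ 3 * h y) ^+ 5 *
  (h (P ^+ 3 * D) + X * h (P ^+ 2 * A * D) + X ^+ 2 * h (P * A ^+ 2 * D)
   + X ^+ 3 * h (A ^+ 3 * D))
  = h B0 + X * h B1 + X ^+ 2 *
  h ((7 * P ^+ 4 * A ^+ 2 + X * A ^+ 6) * f ^+ 5 * D
   + X * (P ^+ 6 + 7 * X * P ^+ 2 * A ^+ 4) * (8 * f ^+ 3 * y ^+ 2) * D)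
  + X ^+ 3 *
  h (8 * P ^+ 3 * A ^+ 3 * f ^+ 5 * D
   + (P ^+ 6 + 7 * X * P ^+ 2 * A ^+ 4) * (6 * f ^+ 4 * y) * D).
Proof.
exists ((P ^+ 6 + 7 * X * P ^+ 2 * A ^+ 4) * f ^+ 5 * D
   + X * (4 * P ^+ 5 * A + 4 * X * P * A ^+ 5) * (6 * f ^+ 4 * y) * D
   + X ^+ 2 * (7 * P ^+ 4 * A ^+ 2 + X * A ^+ 6) * (8 * f ^+ 3 * y ^+ 2) * D),
  ((4 * P ^+ 5 * A + 4 * X * P * A ^+ 5) * f ^+ 5 * D
   + X * (7 * P ^+ 4 * A ^+ 2 + X * A ^+ 6) * (6 * f ^+ 4 * y) * D).
rewrite !(rmorphD, rmorphM, rmorphXn, rmorph_nat) /= hX.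
move: (h P) (h A) (h f) (h y) (h D) => p a g z d.
(* The cofactor is (p+Xa)(p^2+X^2a^2) times d; in the fifth power the binomial coefficients are
   reduced modulo 16. *)
transitivity ((p + X * a) ^+ 4 * (p ^+ 2 + X ^+ 2 * a ^+ 2) * d *
  (g ^+ 5 + 6 * X ^+ 3 * g ^+ 4 * z + 8 * X ^+ 6 * g ^+ 3 * z ^+ 2
   + 16 * (- X ^+ 3 * g ^+ 4 * z + 2 * X ^+ 6 * g ^+ 3 * z ^+ 2 - 5 * X ^+ 9 * g ^+ 2 * z ^+ 3
     + 5 * X ^+ 12 * g * z ^+ 4 - 2 * X ^+ 15 * z ^+ 5))); first by ring.
rewrite L16 mul0r addr0.
(* The sextic in p and a has coefficients 1, 4, 7, 8, 7, 4, 1; the cross products 8*8, 8*6 and 4*8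
   are the multiples of 16 restored here for [ring]. *)
rewrite -[RHS]addr0 -[X in _ = _ + X](mul0r (4 * X ^+ 9 * p ^+ 3 * a ^+ 3 * g ^+ 3 * z ^+ 2 * d
  + 3 * X ^+ 6 * p ^+ 3 * a ^+ 3 * g ^+ 4 * z * d
  + 2 * X ^+ 7 * (p ^+ 5 * a + X ^+ 4 * p * a ^+ 5) * g ^+ 3 * z ^+ 2 * d)) -L16.
by ring.
Qed.

Lemma A2f5_expand : exists B0 B1,
  (h P + X * h A) ^+ 2 * (h f + 2 * X ^+ 3 * h y) ^+ 5
  = h B0 + X * h B1 + X ^+ 2 * h (A ^+ 2 * f ^+ 5 + 8 * X * P ^+ 2 * f ^+ 3 * y ^+ 2)
  + X ^+ 3 * h (10 * P ^+ 2 * f ^+ 4 * y).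
Proof.
exists (P ^+ 2 * f ^+ 5 + 20 * X * P * A * f ^+ 4 * y + 8 * X ^+ 2 * A ^+ 2 * f ^+ 3 * y ^+ 2),
  (2 * P * A * f ^+ 5 + 10 * X * A ^+ 2 * f ^+ 4 * y).
rewrite !(rmorphD, rmorphM, rmorphXn, rmorph_nat) /= hX.
move: (h P) (h A) (h f) (h y) => p a g z.
transitivity ((p + X * a) ^+ 2 *
  (g ^+ 5 + 10 * X ^+ 3 * g ^+ 4 * z + 8 * X ^+ 6 * g ^+ 3 * z ^+ 2
   + 16 * (2 * X ^+ 6 * g ^+ 3 * z ^+ 2 + 5 * X ^+ 9 * g ^+ 2 * z ^+ 3
     + 5 * X ^+ 12 * g * z ^+ 4 + 2 * X ^+ 15 * z ^+ 5))); first by ring.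
rewrite L16 mul0r addr0.
rewrite -[RHS]addr0 -[X in _ = _ + X](mul0r (p * a * X ^+ 7 * g ^+ 3 * z ^+ 2)) -L16.
by ring.
Qed.

Hypotheses (QD : (P ^+ 4 - X * A ^+ 4) * D = 1) (AD : 8 * A * D = 8).
Hypotheses (f4 : 2 * f ^+ 4 = 2) (f1 : 8 * f = 8).

Lemma residue3_simpl :
  8 * P ^+ 3 * A ^+ 3 * f ^+ 5 * D
   + (P ^+ 6 + 7 * X * P ^+ 2 * A ^+ 4) * (6 * f ^+ 4 * y) * D =
  6 * y * P ^+ 2 + 8 * P ^+ 3 * A ^+ 2.
Proof.
(* The difference of the sides as a combination of the hypotheses, from P^6 + 7XP^2A^4 = P^2(P^4 -
   XA^4) + 8XP^2A^4. *)
transitivity (6 * y * P ^+ 2 + 8 * P ^+ 3 * A ^+ 2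
  + 6 * y * P ^+ 2 * f ^+ 4 * ((P ^+ 4 - X * A ^+ 4) * D - 1)
  + 3 * y * P ^+ 2 * (2 * f ^+ 4 - 2)
  + 16 * (3 * X * y * P ^+ 2 * A ^+ 4 * f ^+ 4 * D)
  + P ^+ 3 * A ^+ 3 * D * (1 + f + f ^+ 2 + f ^+ 3 + f ^+ 4) * (8 * f - 8)
  + P ^+ 3 * A ^+ 2 * (8 * A * D - 8)); first by ring.
by rewrite QD f4 f1 AD L16 !subrr !mulr0 mul0r !addr0.
Qed.

Lemma residue2_simpl :
  (7 * P ^+ 4 * A ^+ 2 + X * A ^+ 6) * f ^+ 5 * D
   + X * (P ^+ 6 + 7 * X * P ^+ 2 * A ^+ 4) * (8 * f ^+ 3 * y ^+ 2) * D =
  7 * (A ^+ 2 * f ^+ 5) + 8 * X * (A ^+ 5 + y ^+ 2 * P ^+ 2).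
Proof.
(* Likewise, with also 7P^4A^2 + XA^6 = 7A^2(P^4 - XA^4) + 8XA^6. *)
transitivity (7 * (A ^+ 2 * f ^+ 5) + 8 * X * (A ^+ 5 + y ^+ 2 * P ^+ 2)
  + (7 * A ^+ 2 * f ^+ 5 + 8 * X * f ^+ 3 * y ^+ 2 * P ^+ 2) * ((P ^+ 4 - X * A ^+ 4) * D - 1)
  + X * A ^+ 6 * D * (1 + f + f ^+ 2 + f ^+ 3 + f ^+ 4) * (8 * f - 8)
  + X * A ^+ 5 * (8 * A * D - 8)
  + X * y ^+ 2 * P ^+ 2 * (1 + f + f ^+ 2) * (8 * f - 8)
  + 16 * (4 * X ^+ 2 * f ^+ 3 * y ^+ 2 * P ^+ 2 * A ^+ 4 * D)); first by ring.
by rewrite QD f1 AD L16 !subrr !mulr0 mul0r !addr0.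
Qed.
End Expansions.

(** * Power series over Z/16 *)

Local Notation K := (series 'Z_16).
Implicit Types G : K.

Lemma Z16_nat16 : (16 : K) = 0.
Proof.
by apply: seriesP => n; rewrite coefsMn; case: n => [|n]; apply/val_inj.
Qed.

Lemma Z16_frob (x : 'Z_16) : 8 * x ^+ 2 = 8 * x.
Proof.
case: x => m; do 16 (case: m => [?|m]; first by apply/val_inj).
by [].
Qed.

(** Frobenius modulo 2, carried to modulus 16 by the factor 8: paired terms get 8*2 = 0, and the
    middle square obeys [Z16_frob]. *)
Lemma series_frob G : 8 * G ^+ 2 = 8 * dil 2 G.
Proof.
apply: seriesP => n; rewrite !coefs_natM coefsM.
rewrite (sum_symm_pairs (u := fun i => G.@[i] * G.@[n - i])); last first.
  by move=> i lein; rewrite subKn // mulrC.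
rewrite mulrDr mulrnAr -mulrnAl.
rewrite (_ : 8 *+ 2 = 0 :> 'Z_16) ?mul0r ?add0r /=; last exact/val_inj.
rewrite dvdn2; case: (boolP (odd n)) => [_|n_even] /=; first by rewrite mulr0.
by rewrite -divn2 (_ : n - n %/ 2 = n %/ 2)%N -?expr2 ?Z16_frob //; lia.
Qed.

Lemma odd_powers_mod16 G : (exists x, G = 1 + 2 * x) ->
  [/\ G ^+ 8 = 1, 2 * G ^+ 4 = 2 & 8 * G = 8].
Proof.
case=> x ->; split.
- transitivity (1 + 16 * (x + 7 * x ^+ 2 + 28 * x ^+ 3 + 70 * x ^+ 4
     + 112 * x ^+ 5 + 112 * x ^+ 6 + 64 * x ^+ 7 + 16 * x ^+ 8)); first by ring.
  by rewrite Z16_nat16 mul0r addr0.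
- transitivity (2 + 16 * (x + 3 * x ^+ 2 + 4 * x ^+ 3 + 2 * x ^+ 4)); first by ring.
  by rewrite Z16_nat16 mul0r addr0.
- transitivity (8 + 16 * x : K); first by ring.
  by rewrite Z16_nat16 mul0r addr0.
Qed.

(** * Coefficients of the reciprocal of F modulo 16 *)

Section Main.
Notation P := (thetaP 'Z_16 1).
Notation A := (thetaP 'Z_16 2).
Notation F := (thetaM 'Z_16 2).
Notation f := (thetaP 'Z_16 0).
Notation fm := (thetaM 'Z_16 0).
Notation y := (psi3 'Z_16).
Variables S Qi : K.
Hypothesis SF : S * F = 1.
Hypothesis QiE : Qi = S * fm ^+ 5.

Let f_facts := odd_powers_mod16 (@thetaP0_mod2 _).
Let fm_facts := odd_powers_mod16 (@thetaM0_mod2 _).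

(** The quartic is F fm^3, and fm^8 = 1 makes fm^5 the inverse of fm^3. *)
Lemma quartic_mulV : (P ^+ 4 - Xs * A ^+ 4) * Qi = 1.
Proof.
have [fm8 _ _] := fm_facts; rewrite theta_quartic QiE.
transitivity ((S * F) * fm ^+ 8); first by ring.
by rewrite SF fm8 mulr1.
Qed.

(** Modulo 2, fm is 1 and F equals A. Hence [Qi] inverts A modulo 2. *)
Lemma quartic_mod2 : 8 * (P ^+ 4 - Xs * A ^+ 4) = 8 * A.
Proof.
have [_ _ fm1] := fm_facts; rewrite theta_quartic.
transitivity ((8 * fm) * fm ^+ 2 * F); first by ring.
rewrite fm1; transitivity ((8 * fm) * fm * F); first by ring.
rewrite fm1; transitivity ((8 * fm) * F); first by ring.
rewrite fm1 thetaM2_split.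
transitivity (8 * (dil 4 P + Xs * dil 4 A) - 16 * (Xs * dil 4 A)); first by ring.
by rewrite -thetaP2_split Z16_nat16 mul0r subr0.
Qed.

Lemma A_mulV_mod2 : 8 * A * Qi = 8.
Proof. by rewrite -quartic_mod2 -mulrA quartic_mulV mulr1. Qed.

Lemma S_dissect :
  S = dissect4 (P ^+ 3 * Qi) (P ^+ 2 * A * Qi) (P * A ^+ 2 * Qi) (A ^+ 3 * Qi).
Proof.
set N := dissect4 _ _ _ _.
suff E : F * N = 1 by rewrite -[LHS]mulr1 -E mulrA SF mul1r.
rewrite thetaM2_split (@linear_quartic_expand _ (dil 4) Xs P A Qi (dilX _ _)).
by rewrite quartic_mulV rmorph1.
Qed.

(** [Qi] is S fm^5, so the dissection of S applies a second time. *)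
Lemma A3V_dissect : exists B0 B1, A ^+ 3 * Qi = dissect4 B0 B1
  (7 * (A ^+ 2 * f ^+ 5) + 8 * Xs * (A ^+ 5 + y ^+ 2 * P ^+ 2))
  (6 * y * P ^+ 2 + 8 * P ^+ 3 * A ^+ 2).
Proof.
have [_ f4 f1] := f_facts.
have [B0 [B1 E]] := @A3V_expand _ (dil 4) Xs P A f y Qi (dilX _ _) Z16_nat16.
exists B0, B1; move: E.
rewrite (residue3_simpl _ Z16_nat16 quartic_mulV A_mulV_mod2 f4 f1).
rewrite (residue2_simpl _ Z16_nat16 quartic_mulV A_mulV_mod2 f1) /dissect4 => <-.
rewrite -thetaP2_split -thetaM0_split -/(dissect4 _ _ _ _) -S_dissect {1}QiE.
by rewrite -mulrA [S * _]mulrC.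
Qed.

Lemma coef_S_16n15 n : S.@[16 * n + 15] = (6 * y * P ^+ 2 + 8 * P ^+ 3 * A ^+ 2).@[n].
Proof.
rewrite (_ : 16 * n + 15 = 4 * (4 * n + 3) + 3)%N; last by lia.
have [B0 [B1 E]] := A3V_dissect.
by rewrite S_dissect coef_dissect4_3 E coef_dissect4_3.
Qed.

Lemma coef_S_16n11 n : S.@[16 * n + 11] =
  (7 * (A ^+ 2 * f ^+ 5) + 8 * Xs * (A ^+ 5 + y ^+ 2 * P ^+ 2)).@[n].
Proof.
rewrite (_ : 16 * n + 11 = 4 * (4 * n + 2) + 3)%N; last by lia.
have [B0 [B1 E]] := A3V_dissect.
by rewrite S_dissect coef_dissect4_3 E coef_dissect4_2.
Qed.

(** 3n^2 + n = n(3n+1) is always even. *)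
Lemma P_even : exists P', P = dil 2 P'.
Proof.
apply: gser_even => n; rewrite /qexp mul1r.
rewrite (_ : 3 * n ^+ 2 + n = n * (3 * n + 1)); last by ring.
by rewrite abszM oddM; lia.
Qed.

Lemma y_even : exists y', y = dil 2 y'.
Proof. by apply: gser_even => n; rewrite oddM oddD oddM andbb addbb andbF. Qed.

Lemma coef_even_odd G n : (exists G', G = dil 2 G') -> G.@[2 * n + 1] = 0.
Proof. by case=> G' ->; rewrite coef_dilM_mod. Qed.

Lemma series_frob4 G : 8 * G ^+ 4 = 8 * dil 4 G.
Proof.
rewrite (exprM G 2 2) series_frob rmorphXn /= series_frob dil_dil //.
Qed.

Lemma yP2_even k : exists G, k%:R * y * P ^+ 2 = dil 2 G.
Proof.
have [P' ->] := P_even; have [y' ->] := y_even; exists (k%:R * y' * P' ^+ 2).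
by rewrite !rmorphM rmorph_nat.
Qed.

(** y and P are series in q^2, so modulo 2 their squares are series in q^4. *)
Lemma y2P2_mod2 : exists G, 8 * (y ^+ 2 * P ^+ 2) = 8 * dil 4 G.
Proof.
have [P' ->] := P_even; have [y' ->] := y_even; exists (y' * P').
rewrite mulrA series_frob; transitivity ((8 * dil 2 P' ^+ 2) * dil 2 (dil 2 y')).
  by ring.
rewrite series_frob !dil_dil // (_ : 2 * 2 = 4)%N // (rmorphM (dil 4)) /=; ring.
Qed.

(** A^2 f^5 reappears in its own residue-2 component; this self-similarity gives the third
    congruence from the same vanishing as the second. *)
Lemma A2f5_dissect : exists B0 B1, A ^+ 2 * f ^+ 5 = dissect4 B0 B1
  (A ^+ 2 * f ^+ 5 + 8 * Xs * (y ^+ 2 * P ^+ 2)) (10 * y * P ^+ 2).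
Proof.
have [_ f4 f1] := f_facts.
have [B0 [B1 E]] := @A2f5_expand _ (dil 4) Xs P A f y (dilX _ _) Z16_nat16.
exists B0, B1; move: E; rewrite -thetaP2_split -thetaP0_split.
have -> : 8 * Xs * P ^+ 2 * f ^+ 3 * y ^+ 2 = 8 * Xs * (y ^+ 2 * P ^+ 2).
  transitivity (8 * Xs * (y ^+ 2 * P ^+ 2)
     + Xs * (y ^+ 2 * P ^+ 2) * (1 + f + f ^+ 2) * (8 * f - 8)); first by ring.
  by rewrite f1 subrr mulr0 addr0.
suff -> : 10 * P ^+ 2 * f ^+ 4 * y = 10 * y * P ^+ 2 by [].
transitivity (5 * P ^+ 2 * y * (2 * f ^+ 4)); first by ring.
by rewrite f4; ring.
Qed.

Lemma coef_A2f5_8n7 n : (A ^+ 2 * f ^+ 5).@[4 * (2 * n + 1) + 3] = 0.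
Proof.
have [B0 [B1 ->]] := A2f5_dissect; rewrite coef_dissect4_3.
exact/coef_even_odd/yP2_even.
Qed.

(** Modulo 2, A^5 = A(q^4) A with A = P(q^4) + q A(q^4), and y^2 P^2 is a series in q^4; after
    multiplication by q only residues 1 and 2 occur. *)
Lemma XA5_mod2_dissect : exists B,
  8 * Xs * (A ^+ 5 + y ^+ 2 * P ^+ 2) = dissect4 0 B (8 * A ^+ 2) 0.
Proof.
have [G EG] := y2P2_mod2; exists (8 * (A * P + G)).
transitivity (Xs * ((8 * A ^+ 4) * A + 8 * (y ^+ 2 * P ^+ 2))); first by ring.
rewrite EG series_frob4 {2}thetaP2_split /dissect4 rmorph0.
have -> : dil 4 (8 * (A * P + G)) = 8 * (dil 4 A * dil 4 P + dil 4 G).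
  by rewrite rmorphM rmorph_nat rmorphD /= (rmorphM (dil 4) A).
have -> : dil 4 (8 * A ^+ 2) = 8 * dil 4 A ^+ 2 by rewrite rmorphM rmorph_nat rmorphXn.
by ring.
Qed.

Lemma coef_XyP2_4n3 n : (8 * Xs * (y ^+ 2 * P ^+ 2)).@[4 * n + 3] = 0.
Proof.
have [G EG] := y2P2_mod2; rewrite -mulrA [Xs * _]mulrC mulrA EG.
rewrite (_ : 8 * dil 4 G * Xs = dissect4 0 (8 * G) 0 0) ?coef_dissect4_3 //.
by rewrite /dissect4 !rmorph0 rmorphM rmorph_nat; ring.
Qed.

Lemma A2_odd_mod2 n : (8 * A ^+ 2).@[2 * n + 1] = 0.
Proof.
by apply: coef_even_odd; rewrite series_frob; exists (8 * A); rewrite rmorphM rmorph_nat.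
Qed.

Lemma coef_S_32n31 n : S.@[32 * n + 31] = 0.
Proof.
rewrite (_ : 32 * n + 31 = 16 * (2 * n + 1) + 15)%N; last by lia.
rewrite coef_S_16n15 coefsD (coef_even_odd _ (yP2_even _)) add0r.
have [P' EP] := P_even; apply: coef_even_odd; exists (8 * P' ^+ 3 * A).
by rewrite mulrAC series_frob EP 2!rmorphM /= rmorphXn rmorph_nat mulrAC.
Qed.

Lemma coef_S_128n123 n : S.@[128 * n + 123] = 0.
Proof.
rewrite (_ : 128 * n + 123 = 16 * (4 * (2 * n + 1) + 3) + 11)%N; last by lia.
rewrite coef_S_16n11 coefsD coefs_natM coef_A2f5_8n7 mulr0 add0r.
by have [B ->] := XA5_mod2_dissect; rewrite coef_dissect4_3.
Qed.

Lemma coef_S_512n491 n : S.@[512 * n + 491] = 0.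
Proof.
rewrite (_ : 512 * n + 491 = 16 * (4 * (4 * (2 * n + 1) + 3) + 2) + 11)%N; last by lia.
have [B0 [B1 EA]] := A2f5_dissect; have [B EX] := XA5_mod2_dissect.
rewrite coef_S_16n11 coefsD coefs_natM EX {1}EA !coef_dissect4_2.
rewrite coefsD coef_A2f5_8n7 coef_XyP2_4n3.
rewrite (_ : 4 * (2 * n + 1) + 3 = 2 * (4 * n + 3) + 1)%N; last by lia.
by rewrite A2_odd_mod2 !addr0 mulr0.
Qed.
End Main.

(** * The triple product *)

Section QBinomial.
Variables (R : comNzRingType) (q : R).

(** The Gaussian binomial coefficient, given by a q-Pascal rule to avoid division. *)
Fixpoint qbin (m k : nat) : R :=
  match m, k with
  | _, 0 => 1
  | 0, _.+1 => 0
  | m'.+1, k'.+1 => qbin m' k' + q ^+ k * qbin m' k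
  end.

Lemma qbinn0 m : qbin m 0 = 1. Proof. by case: m. Qed.
Lemma qbinSS m k : qbin m.+1 k.+1 = qbin m k + q ^+ k.+1 * qbin m k.+1.
Proof. by []. Qed.

Arguments qbin : simpl never.

Lemma qbin_small m k : (m < k)%N -> qbin m k = 0.
Proof.
elim: m k => [|m IHm] [|k] // lt; rewrite qbinSS !IHm ?mulr0 ?addr0 //.
exact: ltnW.
Qed.

(** Induction splits off the factor j = 0 and replaces v by vq in the others. *)
Lemma qbinomial (u v : R) m : \prod_(j < m) (u + v * q ^+ j) =
  \sum_(k < m.+1) q ^+ 'C(k, 2) * qbin m k * u ^+ (m - k) * v ^+ k.
Proof.
elim: m v => [|m IHm] v; first by rewrite big_ord0 big_ord1 !mulr1.
rewrite big_ord_recl expr0 mulr1.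
under eq_bigr => j _ do rewrite lift0 exprS mulrA.
rewrite IHm mulrDl !mulr_sumr.
rewrite [RHS]big_ord_recl subn0 qbinn0 bin0n expr0 !mulr1 !mul1r.
rewrite [X in X + _]big_ord_recl subn0 qbinn0 bin0n expr0 !mulr1 !mul1r -exprS -addrA.
congr (_ + _).
under [RHS]eq_bigr => k _.
  rewrite lift0 subSS qbinSS mulrDr 2!mulrDl; over.
rewrite big_split /= addrC; congr (_ + _).
  apply: eq_bigr => k _; rewrite binS bin1 exprMn exprD exprS; ring.
rewrite [RHS]big_ord_recr /= qbin_small // !mulr0 !mul0r addr0.
apply: eq_bigr => k _; rewrite /bump !add1n exprMn.
have -> : (m - k = (m - k.+1).+1)%N by have := ltn_ord k; lia.
by rewrite (exprS u); ring.
Qed.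

(** The quotient formula with denominators cleared; for k > m the factor j = m is 1 - q^0 = 0. *)
Lemma qbin_fact m k : qbin m k * \prod_(j < k) (1 - q ^+ j.+1) =
  \prod_(j < k) (1 - q ^+ (m - j)).
Proof.
elim: m k => [|m IHm] [|k]; rewrite ?big_ord0 ?qbinn0 ?mulr1 //.
  by rewrite mul0r big_ord_recl /= subrr mul0r.
rewrite qbinSS mulrDl {1}big_ord_recr /= mulrA IHm -mulrA IHm.
rewrite [RHS]big_ord_recl subn0 big_ord_recr.
under [in RHS]eq_bigr => j _ do rewrite lift0 subSS.
rewrite /=; have [lekm|ltmk] := leqP k m.
  set p := \prod_(i < k) _.
  have -> : q ^+ m.+1 = q ^+ k.+1 * q ^+ (m - k).
    by rewrite -exprD; congr (_ ^+ _); lia.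
  ring.
suff -> : \prod_(i < k) (1 - q ^+ (m - i)) = 0 by rewrite !(mul0r, mulr0) addr0.
by rewrite (bigD1 (Ordinal ltmk)) //= subnn subrr mul0r.
Qed.
End QBinomial.

(** * The triple product as a limit of the q-binomial theorem *)

Section TripleProduct.
Local Notation q6 := ('X^6 : {poly int}).
Implicit Types p : {poly int}.

Lemma prod_eq1_modXn d (I : Type) (r : seq I) (Pr : pred I) (F : I -> {poly int}) :
  (forall i, Pr i -> exists p, F i = 1 + 'X^d * p) ->
  exists p, \prod_(i <- r | Pr i) F i = 1 + 'X^d * p.
Proof.
move=> EF; apply: (big_ind (fun P => exists p, P = 1 + 'X^d * p)) => //.
- by exists 0; rewrite mulr0 addr0.
- by move=> _ _ [p ->] [p' ->]; exists (p + p' + 'X^d * (p * p')); ring.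
Qed.

Lemma sub_Xn_eq1_modXn d k : (d <= k)%N -> exists p, 1 - q6 ^+ k = 1 + 'X^(6 * d) * p.
Proof.
move=> le; exists (- 'X^(6 * (k - d))); rewrite mulrN -exprD -exprM.
by congr (1 - 'X^_); lia.
Qed.

(** By [qbin_fact] the product consists of factors 1 - q^i with i > 2N - k and factors with i >
    k. *)
Lemma qbin_eq1_modXn N k : (k <= N.*2)%N -> exists p,
  qbin q6 N.*2 k * \prod_(j < N.*2) (1 - q6 ^+ j.+1) =
  1 + 'X^(6 * (minn k (N.*2 - k)).+1) * p.
Proof.
move=> le; rewrite -(big_mkord xpredT (fun j => 1 - q6 ^+ j.+1)).
rewrite (@big_cat_nat _ _ _ k) //= big_mkord mulrA qbin_fact.
have [p ->] : exists p, \prod_(j < k) (1 - q6 ^+ (N.*2 - j)) =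
    1 + 'X^(6 * (minn k (N.*2 - k)).+1) * p.
  by apply: prod_eq1_modXn => j _; apply: sub_Xn_eq1_modXn; have := ltn_ord j; lia.
have [p' ->] : exists p, \prod_(k <= j < N.*2) (1 - q6 ^+ j.+1) =
    1 + 'X^(6 * (minn k (N.*2 - k)).+1) * p.
  rewrite big_nat; apply: prod_eq1_modXn => j /andP[lj _]; apply: sub_Xn_eq1_modXn; lia.
by exists (p + p' + 'X^(6 * (minn k (N.*2 - k)).+1) * (p * p')); ring.
Qed.

Lemma sqr_bin2 k : (k * k = k + 2 * 'C(k, 2))%N.
Proof. by elim: k => // k IHk; rewrite binS bin1; lia. Qed.

Definition pair_prod N : {poly int} :=
  (\prod_(k < N) (1 - 'X^(1 + 6 * k))) * (\prod_(k < N) (1 - 'X^(5 + 6 * k))).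

(* The exponents of the q-binomial theorem with q = X^6, u = X^(6N-1) and v = -1. *)
Lemma qexp_shift N k : (0 < N)%N -> (k <= N.*2)%N ->
  (6 * 'C(k, 2) + (6 * N - 1) * (N.*2 - k) =
   (6 * 'C(N, 2) + (6 * N - 1) * N) + qexp 2 (N%:Z - k%:Z))%N.
Proof.
case: N => // N _ le; have [j Ej] : exists j, N.+1.*2 = (k + j)%N.
  by exists (N.+1.*2 - k)%N; rewrite subnKC.
rewrite Ej addKn (_ : 6 * N.+1 - 1 = 6 * N + 5)%N; last by lia.
have jE : j%:Z = 2 * N%:Z + 2 - k%:Z by lia.
have Ek : (k * k)%:Z = (k + 2 * 'C(k, 2))%:Z by rewrite -sqr_bin2.
have EN : (N.+1 * N.+1)%:Z = (N.+1 + 2 * 'C(N.+1, 2))%:Z by rewrite -sqr_bin2.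
apply: posz_inj; rewrite !PoszD qexpE // !PoszM !PoszD jE ?PoszM.
move: Ek EN; rewrite !PoszD !PoszM; nia.
Qed.

Lemma prod_low_half N : (0 < N)%N -> \prod_(j < N) ('X^(6 * N - 1) - q6 ^+ j) =
  (-1) ^+ N * 'X^(6 * 'C(N, 2)) * \prod_(k < N) (1 - 'X^(5 + 6 * k)) :> {poly int}.
Proof.
move=> N0; rewrite [X in _ = _ * X](reindex_inj rev_ord_inj) /=.
have -> : (-1) ^+ N * 'X^(6 * 'C(N, 2)) = \prod_(j < N) (- q6 ^+ j) :> {poly int}.
  elim: N {N0} => [|N IHN]; first by rewrite big_ord0 !mulr1.
  rewrite big_ord_recr /= -IHN binS bin1 mulnDr exprD (exprS (-1)) -exprM; ring.
rewrite -big_split /=; apply: eq_bigr => j _.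
rewrite mulrBr mulr1 mulNr opprK addrC; congr (_ + _).
by rewrite -exprM -exprD; congr ('X^_); have := ltn_ord j; lia.
Qed.

Lemma prod_high_half N : (0 < N)%N -> \prod_(j < N) ('X^(6 * N - 1) - q6 ^+ (N + j)) =
  'X^((6 * N - 1) * N) * \prod_(k < N) (1 - 'X^(1 + 6 * k)) :> {poly int}.
Proof.
move=> N0; have -> : 'X^((6 * N - 1) * N) = \prod_(j < N) 'X^(6 * N - 1) :> {poly int}.
  by rewrite prodr_const card_ord exprM.
rewrite -big_split /=.
apply: eq_bigr => j _; rewrite mulrBr mulr1; congr (_ - _).
by rewrite -exprM -exprD; congr ('X^_); lia.
Qed.

(** The finite triple product: the q-binomial theorem with 2N factors, centred at N. Multiplying by
    X^M avoids negative exponents. *)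
Lemma pair_prod_sum N : (0 < N)%N -> pair_prod N =
  \sum_(k < N.*2.+1) (-1) ^+ (N + k) * 'X^(qexp 2 (N%:Z - k%:Z)) * qbin q6 N.*2 k.
Proof.
move=> N0; set M := (6 * 'C(N, 2) + (6 * N - 1) * N)%N.
have XM : 'X^M != 0 :> {poly int} by rewrite monic_neq0 ?monicXn.
apply: (mulfI XM); transitivity ((-1) ^+ N * \prod_(j < N.*2) ('X^(6 * N - 1) - q6 ^+ j)).
  rewrite -addnn big_split_ord /= prod_low_half // prod_high_half // /pair_prod /M exprD.
  transitivity (((-1) ^+ N * (-1) ^+ N : {poly int}) *
   ('X^(6 * 'C(N, 2)) * 'X^((6 * N - 1) * N) *
   (\prod_(k < N) (1 - 'X^(1 + 6 * k)) * \prod_(k < N) (1 - 'X^(5 + 6 * k)))));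
    last by ring.
  by rewrite -expr2 sqrr_sign mul1r.
rewrite (eq_bigr (fun j : 'I_N.*2 => 'X^(6 * N - 1) + -1 * q6 ^+ j)); last first.
  by move=> j _; rewrite mulN1r.
rewrite qbinomial !mulr_sumr; apply: eq_bigr => -[k lek] _ /=.
transitivity ((-1) ^+ N * (-1) ^+ k *
  ('X^(6 * 'C(k, 2)) * 'X^((6 * N - 1) * (N.*2 - k))) * qbin q6 N.*2 k).
  by rewrite -!exprM; ring.
by rewrite -(exprD 'X) qexp_shift // -/M !exprD; ring.
Qed.

Lemma triple_product n N : (n < N)%N ->
  (pair_prod N * \prod_(k < N.*2) (1 - 'X^(6 + 6 * k)))`_n = (thetaM int 2).@[n].
Proof.
move=> ltnN; have N0 : (0 < N)%N by lia.
rewrite pair_prod_sum // mulr_suml coef_sum.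
transitivity (\sum_(k < N.*2.+1) (-1) ^+ (N + k) * (qexp 2 (N%:Z - k%:Z) == n)%:R : int).
  apply: eq_bigr => -[k lek] _ /=; have [p E] := qbin_eq1_modXn lek.
  have {}E : qbin q6 N.*2 k * \prod_(j < N.*2) (1 - 'X^(6 + 6 * j)) =
      1 + 'X^(6 * (minn k (N.*2 - k)).+1) * p.
    rewrite -E; congr (_ * _); apply: eq_bigr => j _.
    by rewrite -exprM mulnS.
  set d := (6 * _)%N in E.
  transitivity (((-1) ^+ (N + k) *
    ('X^(qexp 2 (N%:Z - k%:Z)) + 'X^(qexp 2 (N%:Z - k%:Z) + d) * p) : {poly int})`_n).
    congr (polyseq _)`_n.
    apply: (etrans (esym (mulrA _ _ _)) (etrans (congr1 ( *%R _) E) _)).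
    by rewrite !exprD; ring.
  rewrite -signr_odd -[RHS]/(_ * _) -[X in _ = X * _]signr_odd.
  (* With t = |N - k| = N - min(k, 2N-k), the error starts at degree at least 6N + 3t^2 - 8t + 6 >
     6N, beyond n. *)
  rewrite mulr_sign [RHS]mulr_sign; have le : (n < qexp 2 (N%:Z - k%:Z) + d)%N.
    have : (qexp 2 (N%:Z - k%:Z))%:Z =
        3 * (N%:Z - k%:Z) ^+ 2 + 2%:Z * (N%:Z - k%:Z) by rewrite qexpE.
    by rewrite expr2 /d; nia.
  have E1 : ('X^(qexp 2 (N%:Z - k%:Z)) + 'X^(qexp 2 (N%:Z - k%:Z) + d) * p)`_n =
      (qexp 2 (N%:Z - k%:Z) == n)%:R.
    by rewrite coefD coefXn coefXnM le addr0 eq_sym.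
  by case: (odd _); rewrite ?coefN E1.
(* The integers from -N to N contain every solution of 3i^2 + 2i = n, since n < N. *)
pose s : seq int := [seq N%:Z - k%:Z | k <- index_iota 0 N.*2.+1].
have us : uniq s by rewrite map_inj_uniq ?iota_uniq // => i j; lia.
rewrite (gser_coef _ us); last first.
  move=> i Ei; apply/mapP; exists `|N%:Z - i|%N; rewrite ?mem_index_iota;
  have : (qexp 2 i)%:Z = 3 * i ^+ 2 + 2%:Z * i by rewrite qexpE.
    by rewrite Ei expr2; nia.
  by rewrite Ei expr2; nia.
rewrite big_map big_mkord [RHS]big_mkcond /=.
apply: eq_bigr => k _; case: eqP => _; rewrite ?mulr1 ?mulr0 // /sgnz.
by rewrite -signr_odd -[RHS]signr_odd; congr (_ ^+ nat_of_bool _); lia.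
Qed.
End TripleProduct.

(** * Transfer between the integer coefficients and Z/16 *)

Lemma schur_product_theta n :
  fps_mul (fps_mul (qpoch 1 6) (qpoch 5 6)) (qpoch 6 6) n = (thetaM int 2).@[n].
Proof.
rewrite -(triple_product (ltnSn n)) coefM; apply: eq_bigr => i _.
rewrite qpoch_coef //; last by rewrite -addnn; have := ltn_ord i; lia.
congr (_ * _); rewrite /pair_prod coefM; apply: eq_bigr => j _.
have := ltn_ord i; have := ltn_ord j; rewrite !ltnS => lj li.
by rewrite !qpoch_coef // ltnS ?(leq_trans lj li) // (leq_trans (leq_subr _ _) li).
Qed.

Lemma thetaM_intr (R : comNzRingType) n : (thetaM int 2).@[n]%:~R = (thetaM R 2).@[n].
Proof.
have [s us es] := locfinP n (@locfin_qexp 2 isT).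
have es' i : qexp 2 i = n -> i \in s by move=> ei; apply: es; rewrite ei.
rewrite !(gser_coef _ us es') rmorph_sum /=; apply: eq_bigr => i _.
by rewrite /sgnz rmorph_sign.
Qed.

Lemma intr_Z16_eq0 (x : int) : x%:~R = 0 :> 'Z_16 -> (x = 0 %[mod 16])%Z.
Proof.
rewrite {1}(divz_eq x 16) mod0z rmorphD rmorphM /=.
have -> : (16 : int)%:~R = 0 :> 'Z_16 by apply/val_inj.
have : (0 <= x %% 16)%Z by rewrite modz_ge0.
have := ltz_pmod x (d := 16) isT; case: (x %% 16)%Z => // r lt _.
rewrite mulr0 add0r => /(congr1 val) /=; rewrite val_Zp_nat // => E.
by rewrite modn_small in E; [rewrite E|lia].
Qed.

Definition schurZ16 : series 'Z_16 := Series (fun n => (schurS n)%:~R).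

Lemma schurZ16_theta : schurZ16 * thetaM 'Z_16 2 = 1.
Proof.
apply: seriesP => n; rewrite coefs1 coefsM.
have := congr1 (fun x : int => x%:~R : 'Z_16) (schurS_genfun n).
rewrite /fps_one rmorph_nat => <-; rewrite [X in X _ _ n]/fps_mul rmorph_sum.
apply: eq_bigr => i _; rewrite -thetaM_intr -schur_product_theta.
exact/esym/rmorphM.
Qed.

Theorem theorem4p1 (n : nat) :
  [/\ (schurS (32 * n + 31)%N = 0 %[mod 16])%Z,
      (schurS (128 * n + 123)%N = 0 %[mod 16])%Z
    & (schurS (512 * n + 491)%N = 0 %[mod 16])%Z].
Proof.
split; apply: intr_Z16_eq0.
- exact: (coef_S_32n31 schurZ16_theta erefl).
- exact: (coef_S_128n123 schurZ16_theta erefl).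
- exact: (coef_S_512n491 schurZ16_theta erefl).
Qed.
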